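(* Let $H$ and $K$ be finite abelian groups and let $G = H \times K$ be their direct product. Then, as polynomials in the indeterminates $x_g$ ($g \in G$) with complex coefficients, $$ \Theta(G) = \prod_{\chi \in \widehat{K}} \Theta(H)\left[ x_{h} \mapsto \sum_{k \in K} \chi(k)\, x_{hk} \right]. $$
   Context: For a finite group $G$, let $x_g$ be an indeterminate for each $g \in G$. The group determinant of $G$ is $\Theta(G) := \det\left( x_{gh^{-1}} \right)_{g,h \in G} \in \mathbb{Z}[x_g]$, where $\mathbb{Z}[x_g]$ is the multivariate polynomial ring over $\mathbb{Z}$ in the indeterminates $x_g$, $g \in G$. For a finite group $G$, $\widehat{G}$ denotes a complete set of representatives of the equivalence classes of irreducible representations of $G$ over $\mathbb{C}$; when $G$ is abelian this is the set of group homomorphisms $G \to \mathbb{C}^{\times}$. $\Theta(G)[x_g \mapsto y_g]$ denotes the polynomial obtained from $\Theta(G)$ by replacing the variable $x_g$ with $y_g$ for every $g \in G$. For $G = H \times K$, $h \in H$, $k \in K$, the product $hk$ denotes the element $(h,k)$ of $G$, so $x_{hk}$ is the indeterminate attached to $(h,k)$. *)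

(* Defs.v *)
From HB Require Import structures.
From mathcomp Require Import all_boot all_order all_algebra all_fingroup.
From mathcomp Require Import cyclic complex reals mpoly.

Set Implicit Arguments.
Unset Strict Implicit.
Unset Printing Implicit Defensive.

Import GRing.Theory.
Local Open Scope ring_scope.

(* Polynomials in indeterminates x_g (g in G) are {mpoly R[#|G|]}; the
   indeterminate x_g is the one numbered enum_rank g. *)
Definition gvar (R : nzRingType) (G : finGroupType) (g : G) :
  {mpoly R[#|G|]} := 'X_(enum_rank g).

(* Listing rows and columns by the same enumeration of G makes the determinant
   independent of that enumeration. *)
Definition group_det (G : finGroupType) : {mpoly int[#|G|]} :=
  \det (\matrix_(i < #|G|, j < #|G|)
          gvar int (enum_val i * (enum_val j)^-1)%g).

(* p[x_g |-> y_g], with the integer coefficients of p read in S. *)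
Definition gsubst (S : comNzRingType) (G : finGroupType)
    (p : {mpoly int[#|G|]}) (y : G -> S) : S :=
  mmap intr (fun i => y (enum_val i)) p.

(* Group homomorphisms G -> F^*, as nowhere zero multiplicative functions. *)
Definition is_lin_char (F : fieldType) (G : finGroupType)
    (f : {ffun G -> F}) : bool :=
  [forall x, f x != 0] && [forall x, forall y, f (x * y)%g == f x * f y].

Record lin_char (F : fieldType) (G : finGroupType) := LinChar {
  lin_char_val :> {ffun G -> F};
  _ : is_lin_char lin_char_val
}.

HB.instance Definition _ (F : fieldType) (G : finGroupType) :=
  [isSub for @lin_char_val F G].
HB.instance Definition _ (F : fieldType) (G : finGroupType) :=
  [Choice of lin_char F G by <:].

(* Over an algebraically closed field lin_char F G is a finType, because the
   values of a homomorphism are #|G|-th roots of unity. *)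
Section LinCharFinite.
Variables (F : closedFieldType) (G : finGroupType).

Definition unity_rts : seq F :=
  sval (closed_field_poly_normal ('X^#|G| - 1 : {poly F})).

Lemma lin_char_unity_rts (f : lin_char F G) x : f x \in unity_rts.
Proof.
have n0 : (0 < #|G|)%N by rewrite -cardsT cardG_gt0.
have /andP[/forallP fn0 /forallP fM] := valP f.
have f1 : f 1%g = 1.
  have /forallP/(_ 1%g)/eqP := fM 1%g; rewrite mulg1 => e.
  by apply: (mulfI (fn0 1%g)); rewrite mulr1 -e.
have fX k : f (x ^+ k)%g = f x ^+ k.
  elim: k => [|k IH]; first by rewrite expg0 expr0.
  by have /forallP/(_ (x ^+ k)%g)/eqP := fM x; rewrite expgS exprS -IH.
have fn : f x ^+ #|G| = 1.
  by rewrite -fX -cardsT expg_cardG ?inE.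
have : root ('X^#|G| - 1) (f x) by rewrite rootE !hornerE fn subrr.
rewrite /unity_rts; case: closed_field_poly_normal => rs /= ->.
by rewrite (monicP _) ?monicXnsubC // scale1r root_prod_XsubC.
Qed.

Definition lin_char_code (f : lin_char F G) : {ffun G -> seq_sub unity_rts} :=
  [ffun x => SeqSub (lin_char_unity_rts f x)].

Definition lin_char_decode (c : {ffun G -> seq_sub unity_rts}) :
  option (lin_char F G) := insub [ffun x => ssval (c x)].

Lemma lin_char_codeK : pcancel lin_char_code lin_char_decode.
Proof.
move=> f; rewrite /lin_char_decode.
have -> : [ffun x => ssval (lin_char_code f x)] = val f.
  by apply/ffunP => x; rewrite !ffunE.
by rewrite valK.
Qed.

HB.instance Definition _ : isCountable (lin_char F G) :=
  PCanIsCountable lin_char_codeK.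
HB.instance Definition _ : isFinite (lin_char F G) :=
  PCanIsFinite lin_char_codeK.
End LinCharFinite.

(* Main.v *)
Require Import Defs.
From HB Require Import structures.
From mathcomp Require Import all_boot all_order all_algebra all_fingroup.
From mathcomp Require Import complex reals mpoly.
From mathcomp Require Import cyclic separable cyclotomic.
Import GRing.Theory.
Local Open Scope ring_scope.

(** The group matrix of H * K, with rows and columns grouped by their
    K-component, is a square array of #|K| x #|K| blocks of size #|H|; the block
    at (k, l) is X(k l^-1), where X(k) is the matrix of the x_(h h'^-1, k). For
    a character chi of K,

      sum_k chi(k) X(k l^-1) = chi(l) * sum_k chi(k) X(k),

    which says that the character table Q = (chi(k)) of K, with every entry
    blown up to a scalar block, turns the group matrix into the block diagonal
    matrix whose chi block is sum_k chi(k) X(k). The determinant of that block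
    is the chi factor of the formula, so the formula follows once Q is known to
    be invertible and can be cancelled (det_mxblock_intertwine,
    det_block_characters).

    That K has exactly #|K| characters and that they are linearly independent
    (lin_char_table) comes from linear algebra: translations by elements of K act on functions on K by
    commuting matrices of finite order, so over an algebraically closed field in
    which #|K| is invertible they have a common eigenbasis. A common
    eigenfunction is, up to its value at 1, a character; as Q is then invertible
    and intertwines the translations with diagonal matrices, any character is
    one of the rows of Q. *)

(** * Determinants *)

Lemma det_reindex (A : comNzRingType) (T : finType) m n
    (f : 'I_m -> T) (g : 'I_n -> T) (F : T -> T -> A) :
    bijective f -> bijective g ->
  \det (\matrix_(i, j) F (f i) (f j)) = \det (\matrix_(i, j) F (g i) (g j)).
Proof.
move=> bijf [g' gK g'K].
have Emn : m = n.
  by have := bij_eq_card bijf; rewrite -(bij_eq_card (Bijective gK g'K)) !card_ord.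
case: _ / Emn in g g' gK g'K *.
have inj_s : injective (g' \o f) by apply: inj_comp (can_inj g'K) (bij_inj bijf).
pose s := perm inj_s; pose G := \matrix_(i, j) F (g i) (g j).
have -> : \matrix_(i, j) F (f i) (f j) = row_perm s (col_perm s G).
  by apply/matrixP=> i j; rewrite !mxE !permE /= !g'K.
rewrite row_permE col_permE !det_mulmx !det_perm odd_permV.
by rewrite mulrCA -signr_addb addbb mulr1.
Qed.

Lemma det_mxdiag (A : comNzRingType) p (d : 'I_p -> nat)
    (B : forall i, 'M[A]_(d i)) :
  \det (\mxdiag_i B i) = \prod_i \det (B i).
Proof.
elim: p => [|p IH] in d B *.
  rewrite [RHS]big_ord0; move: (\mxdiag_i B i) (big_ord0 0%N addn xpredT d).
  by move: (\sum_i d i)%N => n M n0; subst n; exact: det_mx00.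
have det_cast m n (e : m = n) (M : 'M[A]_m) : \det (castmx (e, e) M) = \det M.
  by case: _ / e.
by rewrite mxdiag_recl det_cast [RHS]big_ord_recl -IH det_ublock.
Qed.

(** The scalar blocks P i j form a block matrix that intertwines the block
    matrix X with the block diagonal matrix Y; it is invertible because
    P |-> (blocks P i j) is multiplicative, hence its determinant cancels. *)
Lemma det_mxblock_intertwine (A : comUnitRingType) p q (P : 'M[A]_p)
    (X : 'I_p -> 'I_p -> 'M[A]_q) (Y : 'I_p -> 'M[A]_q) :
    P \in unitmx ->
    (forall i l, \sum_j P i j *: X j l = P i l *: Y i) ->
  \det (\mxblock_(i, j) X i j) = \prod_i \det (Y i).
Proof.
move=> Pu PX.
pose S (Q : 'M[A]_p) := \mxblock_(i < p, j < p) ((Q i j)%:M : 'M[A]_q).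
have SM : S P *m S (invmx P) = 1%:M.
  rewrite mul_mxblock -mxdiagZ; apply: eq_mxblock => i j.
  under eq_bigr do rewrite -scalar_mxM.
  rewrite -raddf_sum /=; have := mulmxV Pu => /matrixP/(_ i j).
  rewrite mxE => ->; rewrite mxE.
  by case: eqVneq => //= _; rewrite ?conform_mx_id ?raddf0.
have Su : \det (S P) \is a GRing.unit by have [] := mulmx1_unit SM.
have : S P *m \mxblock_(i, j) X i j = (\mxdiag_i Y i) *m S P.
  rewrite mul_mxblock mul_mxdiag_mxblock; apply: eq_mxblock => i l.
  by rewrite mul_mx_scalar -PX; apply: eq_bigr => j _; rewrite mul_scalar_mx.
move/(congr1 determinant); rewrite !det_mulmx det_mxdiag mulrC.
exact: mulIr.
Qed.

(** * Characters of a finite abelian group *)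

Section Characters.
Variables (F : closedFieldType) (K : finGroupType).

(** A is annihilated by 'X^m - 1, which is split and separable. *)
Lemma diagonalizable_finite_order n (A : 'M[F]_n) m :
  m%:R != 0 :> F -> A ^+ m = 1 -> diagonalizable A.
Proof.
case: n A => [|n] A nz Am; first by rewrite (flatmx0 A); exact: diagonalizable0.
apply/diagonalizableP.
have [rs Drs] := closed_field_poly_normal ('X^m - 1 : {poly F}).
have m_gt0 : (0 < m)%N by case: m nz {Am Drs} => //; rewrite eqxx.
rewrite (monicP _) ?monicXnsubC // scale1r in Drs.
exists rs; first by rewrite -separable_prod_XsubC -Drs separable_Xn_sub_1.
rewrite -Drs; apply: mxminpoly_min.
by rewrite rmorphB rmorph1 rmorphXn /= horner_mx_X Am subrr.
Qed.

(** Acting on the right of row vectors, read as functions on K, this matrix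
    sends v to l |-> v (k * l). *)
Definition translation_mx (k : K) : 'M[F]_#|K| :=
  \matrix_(i, j) (enum_val i == k * enum_val j)%g%:R.

Lemma mul_translation_mx m (P : 'M[F]_(m, #|K|)) k i j :
  (P *m translation_mx k) i j = P i (enum_rank (k * enum_val j)%g).
Proof.
rewrite mxE (bigD1 (enum_rank (k * enum_val j)%g)) //= big1 => [|l ne_l].
  by rewrite mxE enum_rankK eqxx mulr1 addr0.
rewrite mxE; case: eqP => [e|]; last by rewrite mulr0.
by rewrite -e enum_valK eqxx in ne_l.
Qed.

Lemma translation_mxM k l :
  translation_mx k *m translation_mx l = translation_mx (k * l)%g.
Proof.
by apply/matrixP=> i j; rewrite mul_translation_mx !mxE enum_rankK mulgA.
Qed.

Lemma translation_mx1 : translation_mx 1%g = 1.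
Proof.
by apply/matrixP=> i j; rewrite !mxE mul1g (inj_eq enum_val_inj).
Qed.

Lemma translation_mxX k m : translation_mx (k ^+ m)%g = translation_mx k ^+ m.
Proof.
elim: m => [|m IH]; first by rewrite expg0 expr0 translation_mx1.
by rewrite expgS exprS -translation_mxM IH.
Qed.

Lemma codiagonalize_translations :
    #|K|%:R != 0 :> F -> abelian [set: K] ->
  exists2 P : 'M[F]_#|K|, P \in unitmx &
    exists d : K -> 'rV[F]_#|K|,
      forall k, P *m translation_mx k = diag_mx (d k) *m P.
Proof.
move=> K_nz abelK; have [|P Pu /allP diagP] := (codiagonalizableP (codom translation_mx)).1.
  split=> [_ _ /codomP[k ->] /codomP[l ->]|_ /codomP[k ->]].
    by rewrite /comm_mx !translation_mxM (centsP abelK) ?inE.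
  apply: diagonalizable_finite_order K_nz _.
  have k_exp : (k ^+ #|K| = 1)%g by rewrite -cardsT expg_cardG ?inE.
  by rewrite -translation_mxX k_exp translation_mx1.
exists P => //.
have dP k : exists d, P *m translation_mx k == diag_mx d *m P.
  have /similar_diagPex[d /(similarP Pu) ->] :=
    diagP _ (codom_f translation_mx k).
  by exists d.
by exists (fun k => xchoose (dP k)) => k; apply/eqP/(xchooseP (dP k)).
Qed.

Lemma lin_charM (f : lin_char F K) x y : f (x * y)%g = f x * f y.
Proof. by have /andP[_ /forallP/(_ x)/forallP/(_ y)/eqP] := valP f. Qed.

Lemma lin_char_neq0 (f : lin_char F K) x : f x != 0.
Proof. by have /andP[/forallP/(_ x)] := valP f. Qed.

(** The rows of P simultaneously diagonalizing the translations are the common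
    eigenfunctions. Evaluating the eigenvalue equation at 1 shows that row i at k
    is d k i times its value at 1, so that k |-> d k i is a character c i and P
    is the table Q of the c i up to nonzero row factors: Q is invertible and c is
    injective. A character chi is itself a common eigenfunction; its coordinates
    on the rows of Q can be nonzero only at an i with c i = chi, whence c is
    surjective. *)
Lemma lin_char_table :
    #|K|%:R != 0 :> F -> abelian [set: K] ->
  exists2 c : 'I_#|K| -> lin_char F K, bijective c &
    \matrix_(i < #|K|, j < #|K|) c i (enum_val j) \in unitmx.
Proof.
move=> K_nz abelK.
have [P Pu [d Pd]] := codiagonalize_translations K_nz abelK.
pose one := enum_rank (1%g : K).
have PE i k : P i (enum_rank k) = d k 0 i * P i one.
  have /matrixP/(_ i one) := Pd k; rewrite mul_translation_mx enum_rankK mulg1.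
  by rewrite mul_diag_mx mxE.
have P1_neq0 i : P i one != 0.
  apply/eqP=> P1; have /matrixP/(_ i i) := mulmxV Pu.
  rewrite !mxE eqxx big1 ?(eq_sym 0) => [/eqP|j _]; first by rewrite eq_sym oner_eq0.
  by rewrite -(enum_valK j) PE P1 mulr0 mul0r.
have dM k l i : d (k * l)%g 0 i = d k 0 i * d l 0 i.
  apply: (mulIf (P1_neq0 i)); rewrite -PE -mulrA -PE.
  have /matrixP/(_ i (enum_rank l)) := Pd k.
  by rewrite mul_translation_mx enum_rankK mul_diag_mx mxE.
have d1 i : d 1%g 0 i = 1 by apply: (mulIf (P1_neq0 i)); rewrite -PE mul1r.
have d_char i : is_lin_char [ffun k => d k 0 i].
  apply/andP; split; apply/forallP=> k; last first.
    by apply/forallP=> l; rewrite !ffunE dM.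
  rewrite ffunE; apply: contra_eq_neq (d1 i) => dk.
  by rewrite -(mulgV k) dM dk mul0r eq_sym oner_eq0.
pose c i := LinChar (d_char i).
have cE i k : c i k = d k 0 i by rewrite ffunE.
pose Q : 'M[F]_#|K| := \matrix_(i, j) c i (enum_val j).
have Qu : Q \in unitmx.
  have DQ : P = diag_mx (\row_i P i one) *m Q.
    apply/matrixP=> i j; rewrite mul_diag_mx !mxE cE mulrC -PE.
    by rewrite enum_valK.
  by move: Pu; rewrite DQ unitmx_mul => /andP[].
have Qtrans k : Q *m translation_mx k = diag_mx (d k) *m Q.
  apply/matrixP=> i j; rewrite mul_translation_mx mul_diag_mx !mxE.
  by rewrite enum_rankK !cE dM.
have c_inj : injective c.
  move=> i i' eq_c; have : delta_mx 0 i *m Q = delta_mx 0 i' *m Q :> 'rV_#|K|.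
    by rewrite -!rowE; apply/rowP=> j; rewrite !mxE eq_c.
  move/(can_inj (mulmxK Qu))/rowP/(_ i); rewrite !mxE !eqxx.
  by case: eqVneq => // _ /eqP; rewrite oner_eq0.
have c_surj chi : exists i, c i == chi.
  pose w : 'rV[F]_#|K| := \row_j chi (enum_val j); pose u := w *m invmx Q.
  have wE : u *m Q = w by rewrite mulmxKV.
  have w_neq0 : w != 0.
    apply/eqP=> /rowP/(_ one)/eqP; rewrite !mxE.
    exact/negP/lin_char_neq0.
  have /rV0Pn[i ui] : u != 0.
    by apply: contraNneq w_neq0 => u0; rewrite -wE u0 mul0mx.
  exists i; apply/eqP/val_inj/ffunP=> k.
  have wk : w *m translation_mx k = chi k *: w.
    by apply/rowP=> j; rewrite mul_translation_mx !mxE enum_rankK lin_charM.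
  have uk : u *m diag_mx (d k) = chi k *: u.
    apply: (can_inj (mulmxK Qu)).
    by rewrite -mulmxA -Qtrans mulmxA wE wk -scalemxAl wE.
  apply: (mulIf ui); have /rowP/(_ i) := uk.
  by rewrite mul_mx_diag !mxE -cE mulrC.
exists c => //; exists (fun chi => xchoose (c_surj chi)) => [i|chi].
  exact/c_inj/eqP/(xchooseP (c_surj (c i))).
exact/eqP/(xchooseP (c_surj chi)).
Qed.
End Characters.

(** * Group determinants *)

Lemma gsubst_group_det (S : comNzRingType) (G : finGroupType) (y : G -> S) :
  gsubst (group_det G) y =
  \det (\matrix_(i < #|G|, j < #|G|) y (enum_val i * (enum_val j)^-1)%g).
Proof.
rewrite /gsubst -det_map_mx; congr (\det _); apply/matrixP=> i j.
by rewrite !mxE /gvar /= mmapX mmap1U enum_rankK.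
Qed.

Lemma map_group_det (S : comNzRingType) (G : finGroupType) :
  map_mpoly intr (group_det G) =
  \det (\matrix_(i < #|G|, j < #|G|)
          gvar S (enum_val i * (enum_val j)^-1)%g).
Proof.
rewrite -det_map_mx; congr (\det _); apply/matrixP=> i j.
by rewrite !mxE /gvar /= map_mpolyX.
Qed.

(** Only the order in which the elements of H * K are listed differs: the
    right-hand side lists them by K-component first. *)
Lemma det_prod_group_mx (A : comNzRingType) (H K : finGroupType)
    (x : H * K -> A) :
  \det (\matrix_(i < #|{: H * K}|, j < #|{: H * K}|)
          x (enum_val i * (enum_val j)^-1)%g) =
  \det (\mxblock_(i < #|K|, j < #|K|)
          \matrix_(a < #|H|, b < #|H|)
             x ((enum_val a * (enum_val b)^-1)%g,
                (enum_val i * (enum_val j)^-1)%g)).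
Proof.
pose f (s : 'I_(\sum_(i < #|K|) #|H|)) : H * K :=
  (enum_val (tagnat.sig2 s), enum_val (tagnat.sig1 s)).
have f_bij : bijective f.
  pose g (y : H * K) : 'I_(\sum_(i < #|K|) #|H|) :=
    tagnat.Rank (enum_rank y.2) (enum_rank y.1).
  exists g => [s|[h k]]; rewrite /f /g /=.
    by rewrite !enum_valK tagnat.sig2K.
  by rewrite tagnat.Rank1K tagnat.Rank2K cast_ord_id !enum_rankK.
rewrite (det_reindex _ _ _ _ _ f (fun y z => x (y * z^-1)%g)
           (enum_val_bij _) f_bij).
by congr (\det _); apply/matrixP=> s t; rewrite !mxE.
Qed.

(** The intertwining relation is the change of variable k |-> k * l in
    sum_k (c i k) x(h, k * l^-1), followed by c i (k * l) = c i k * c i l. *)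
Lemma det_block_characters (A : comUnitRingType) (H K : finGroupType)
    (c : 'I_#|K| -> K -> A) (x : H * K -> A) :
    (forall i, {morph c i : k l / (k * l)%g >-> k * l}) ->
    \matrix_(i < #|K|, j < #|K|) c i (enum_val j) \in unitmx ->
  \det (\mxblock_(i < #|K|, j < #|K|)
          \matrix_(a < #|H|, b < #|H|)
             x ((enum_val a * (enum_val b)^-1)%g,
                (enum_val i * (enum_val j)^-1)%g)) =
  \prod_i \det (\matrix_(a < #|H|, b < #|H|)
             \sum_k c i k * x ((enum_val a * (enum_val b)^-1)%g, k)).
Proof.
move=> cM Qu; apply: (det_mxblock_intertwine _ _ _ _ _ _ Qu).
move=> i l; apply/matrixP=> a b; rewrite summxE !mxE mulr_sumr.
have shift_bij : bijective (fun k : K => enum_rank (k * enum_val l)%g).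
  exists (fun j => enum_val j * (enum_val l)^-1)%g => [k|j].
    by rewrite enum_rankK mulgK.
  by rewrite mulgKV enum_valK.
rewrite (reindex _ (onW_bij _ shift_bij)) /=; apply: eq_bigr => k _.
by rewrite !mxE enum_rankK mulgK cM mulrCA mulrA.
Qed.

Theorem theorem1 (R : realType) (H K : finGroupType)
    (abelH : abelian [set: H]) (abelK : abelian [set: K]) :
  map_mpoly intr (group_det (H * K)%type) =
  \prod_(chi : lin_char R[i] K)
     gsubst (group_det H)
       (fun h : H => \sum_(k : K) chi k *: gvar R[i] ((h, k) : (H * K)%type)).
Proof.
have K_nz : #|K|%:R != 0 :> R[i].
  by rewrite Num.Theory.pnatr_eq0 -lt0n -cardsT cardG_gt0.
have [c c_bij Qu] := lin_char_table _ _ K_nz abelK.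
pose n := #|{: H * K}|.
rewrite map_group_det det_prod_group_mx.
rewrite (det_block_characters _ _ _ (fun i k => (c i k)%:MP_[n])) => [|i k l|].
- rewrite [RHS](reindex c) /=; last exact: onW_bij.
  apply: eq_bigr => i _; rewrite gsubst_group_det.
  congr (\det _); apply/matrixP=> a b; rewrite !mxE.
  by apply: eq_bigr => k _; rewrite mul_mpolyC.
- by rewrite lin_charM mpolyCM.
have -> : \matrix_(i < #|K|, j < #|K|) (c i (enum_val j))%:MP_[n] =
    map_mx (@mpolyC n _) (\matrix_(i < #|K|, j < #|K|) c i (enum_val j)).
  by apply/matrixP=> i j; rewrite !mxE.
by rewrite unitmxE det_map_mx; apply: rmorph_unit; rewrite -unitmxE.
Qed.
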